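(* (a) Let $r,r'$ be nonzero complex numbers with $\mathrm{Re}\,r>0$ and $\mathrm{Re}\,r'>0$, and let $\varepsilon,\tilde\varepsilon,\varepsilon',\tilde\varepsilon'\in\{1,-1\}$. If $(\varepsilon,\tilde\varepsilon,r)\neq(\varepsilon',\tilde\varepsilon',r')$, then the representations $R_r^{\varepsilon,\tilde\varepsilon}$ and $R_{r'}^{\varepsilon',\tilde\varepsilon'}$ of $U_q({\rm iso}_2)$ are irreducible and nonequivalent. (b) Let $r\in\mathbf C\setminus\{0\}$, $\varepsilon,\tilde\varepsilon\in\{1,-1\}$, and let $r',s'\in\mathbf C\setminus\{0\}$ with $s'\neq\pm\mathrm{i}q^{m}$ and $s'\neq\pm\mathrm{i}q^{m+1/2}$ for all $m\in\mathbf Z$. Then the representations $R_r^{\varepsilon,\tilde\varepsilon}$ and $R_{r's'}$ of $U_q({\rm iso}_2)$ are nonequivalent.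
   Context: $q$ is a nonzero complex number which is not a root of unity, with a fixed square root $q^{1/2}$; $\mathrm{i}=\sqrt{-1}$. $U_q({\rm iso}_2)$ is the complex associative algebra with unit generated by $I,T_1,T_2$ subject to $$q^{1/2}IT_2-q^{-1/2}T_2I=T_1,\qquad q^{1/2}T_1I-q^{-1/2}IT_1=T_2,\qquad q^{1/2}T_2T_1-q^{-1/2}T_1T_2=0.$$ For $r,s\in\mathbf C\setminus\{0\}$ with $s\neq\pm\mathrm{i}q^n$ for all $n\in\mathbf Z$, $R_{rs}$ is the representation of $U_q({\rm iso}_2)$ on the dense domain $\mathcal D={\rm lin}\{|m\rangle:m\in\mathbf Z\}$ of the Hilbert space with orthonormal basis $|m\rangle$, $m\in\mathbf Z$, given by $$R_{rs}(I)|m\rangle=\mathrm{i}\,\frac{sq^m-s^{-1}q^{-m}}{q-q^{-1}}\,|m\rangle,\qquad R_{rs}(T_2)|m\rangle=\frac{r}{sq^m+s^{-1}q^{-m}}\big\{|m+1\rangle+|m-1\rangle\big\},$$ $$R_{rs}(T_1)|m\rangle=\frac{\mathrm{i}q^{1/2}r}{sq^m+s^{-1}q^{-m}}\big\{sq^m|m+1\rangle-s^{-1}q^{-m}|m-1\rangle\big\}.$$ For $r\in\mathbf C\setminus\{0\}$ and $\varepsilon,\tilde\varepsilon\in\{1,-1\}$, $R=R_r^{\varepsilon,\tilde\varepsilon}$ is the representation of $U_q({\rm iso}_2)$ with domain the space with linear basis $|j\rangle$, $j=0,1,2,\ldots$ (a dense subspace of its Hilbert space completion), given by $$R(I)|j\rangle=-\varepsilon\frac{q^{j+1/2}+q^{-j-1/2}}{q-q^{-1}}|j\rangle,\quad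 j\ge 0,$$ $$R(T_2)|0\rangle=-\varepsilon\frac{r}{q^{1/2}-q^{-1/2}}\big(\tilde\varepsilon|0\rangle+\mathrm{i}|1\rangle\big),\qquad R(T_2)|j\rangle=-\varepsilon\frac{\mathrm{i}r}{q^{j+1/2}-q^{-j-1/2}}\big(|j+1\rangle+|j-1\rangle\big),\ j\ge1,$$ $$R(T_1)|0\rangle=\frac{r}{q^{1/2}-q^{-1/2}}\big(\tilde\varepsilon|0\rangle+\mathrm{i}q|1\rangle\big),\qquad R(T_1)|j\rangle=\frac{\mathrm{i}r}{q^{j+1/2}-q^{-j-1/2}}\big(q^{j+1}|j+1\rangle+q^{-j}|j-1\rangle\big),\ j\ge1.$$ A representation with domain $\mathcal D$ is irreducible if the only invariant linear subspaces of $\mathcal D$ are $0$ and $\mathcal D$. Two representations $\pi,\pi'$ on Hilbert spaces $\mathcal H,\mathcal H'$ (defined on dense invariant domains) are (algebraically) equivalent if there exist everywhere dense invariant subspaces $V\subset\mathcal H$, $V'\subset\mathcal H'$ (contained in the respective domains) and a one-to-one linear operator $A:V\to V'$ (a bijection) such that $A\pi(a)v=\pi'(a)Av$ for all $a\in U_q({\rm iso}_2)$ and $v\in V$; nonequivalent means not equivalent. *)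

(* Defs.v *)
(* The field of complex numbers is R[i], for R : realType. *)
From HB Require Import structures.
From mathcomp Require Import all_boot all_order all_algebra.
From mathcomp Require Import generic_quotient ring_quotient complex.
From mathcomp Require Import finmap.
From mathcomp.multinomials Require Import monalg.
From mathcomp Require Import classical_sets functions boolp reals ereal esum.
From mathcomp Require Import ring.

Set Implicit Arguments.
Unset Strict Implicit.
Unset Printing Implicit Defensive.

Import Order.TTheory GRing.Theory Num.Theory.
Local Open Scope classical_set_scope.
Local Open Scope ring_scope.
Local Open Scope quotient_scope.

Section LinearExtension.
Context (F : comNzRingType) (K : choiceType) (V : lmodType F).

(* The linear map {malg F[K]} -> V with prescribed values f on the basis K. *)
Definition lext (f : K -> V) (v : {malg F[K]}) : V :=
  \sum_(k <- msupp v) v@_k *: f k.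

Lemma lextEw (f : K -> V) (v : {malg F[K]}) (d : {fset K}) :
  fsubset (msupp v) d -> lext f v = \sum_(k <- d) v@_k *: f k.
Proof.
move=> le; rewrite /lext (big_fset_incl _ le) //= => k _ /mcoeff_outdom ->.
by rewrite scale0r.
Qed.

Lemma lext_is_linear (f : K -> V) : linear (lext f).
Proof.
move=> c u v.
pose d := fsetU (msupp (c *: u + v)) (fsetU (msupp u) (msupp v)).
have d1 : fsubset (msupp (c *: u + v)) d by rewrite /d fsubsetUl.
have d2 : fsubset (msupp u) d by rewrite /d fsetUCA fsubsetUl.
have d3 : fsubset (msupp v) d by rewrite /d fsetUC -fsetUA fsetUCA fsubsetUl.
rewrite (lextEw f d1) (lextEw f d2) (lextEw f d3).
rewrite scaler_sumr -big_split /=; apply: eq_bigr => k _.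
by rewrite mcoeffD mcoeffZ scalerDl scalerA.
Qed.
HB.instance Definition _ (f : K -> V) :=
  GRing.isLinear.Build F {malg F[K]} V _ (lext f) (lext_is_linear f).

Lemma lextU (f : K -> V) k : lext f << k >> = f k.
Proof. by rewrite /lext msuppU oner_eq0 big_seq_fset1 mcoeffUU scale1r. Qed.

Lemma malg_lin_ind (P : {malg F[K]} -> Prop) :
  P 0 -> (forall c u v, P u -> P v -> P (c *: u + v)) ->
  (forall k, P << k >>) -> forall v, P v.
Proof.
move=> P0 PD PU v; rewrite [v]monalgE; apply: (big_rec P) => // k u _ Pu.
have -> : << v@_k *g k >> = v@_k *: << k >> :> {malg F[K]}.
  by apply/malgP => k'; rewrite mcoeffZ !mcoeffU mulr_natr.
exact: PD.
Qed.

End LinearExtension.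

(* monalg only makes {malg F[{fmonom I}]} a left algebra. *)
Definition free_alg (F : comNzRingType) (I : choiceType) := {malg F[{fmonom I}]}.

Section FreeAlgebra.
Context (F : comNzRingType) (I : choiceType).

HB.instance Definition _ := GRing.Lalgebra.on (free_alg F I).

Lemma free_alg_scalerAr (c : F) (a b : free_alg F I) :
  c *: (a * b) = a * (c *: b).
Proof.
have cC : c%:MP * a = a * c%:MP.
  rewrite !malgM_def fgmulUg fgmulgU; apply: eq_bigr => w _.
  by rewrite mul1m mulm1 mulrC.
by rewrite -!mul_malgC mulrA [_ * a]cC -mulrA.
Qed.

HB.instance Definition _ :=
  GRing.Lalgebra_isAlgebra.Build F (free_alg F I) free_alg_scalerAr.

Definition free_gen (i : I) : free_alg F I := << fmu i >>.

Lemma free_genM (w1 w2 : {fmonom I}) :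
  (<< w1 >> : free_alg F I) * << w2 >> = << mmul w1 w2 >>.
Proof. by rewrite [LHS]malgM_def fgmulUU mulr1. Qed.

End FreeAlgebra.

Definition two_sided_ideal (A : pzRingType) (J : set A) :=
  [/\ J 0, forall x y, J x -> J y -> J (x + y),
      forall a x, J x -> J (a * x) & forall a x, J x -> J (x * a)].

(* p stands for q^{1/2}: the defining relations involve q only through it. *)
Definition iso2_relators (F : fieldType) (A : algType F) (p : F) (xI x1 x2 : A) :
    set A :=
  [set p *: (xI * x2) - p^-1 *: (x2 * xI) - x1;
       p *: (x1 * xI) - p^-1 *: (xI * x1) - x2;
       p *: (x2 * x1) - p^-1 *: (x1 * x2)].

Lemma iso2_relators_morph (F : fieldType) (A B : algType F) (f : A -> B) p
    (xI x1 x2 x : A) :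
  linear f -> {morph f : a b / a * b} ->
  iso2_relators p xI x1 x2 x -> iso2_relators p (f xI) (f x1) (f x2) (f x).
Proof.
move=> fL fM.
have f0 : f 0 = 0.
  by have := fL (- 1) 0 0; rewrite scaler0 addr0 scaleN1r addNr.
have fZ c a : f (c *: a) = c *: f a by rewrite -[c *: a]addr0 fL f0 addr0.
have fB a b : f (a - b) = f a - f b by rewrite addrC -scaleN1r fL scaleN1r addrC.
move=> [[]|] ->; rewrite !fB !fZ !fM; [left; left|left; right|right]; by [].
Qed.

Section Uq.
Context (R : realType).
Local Notation C := R[i].

Context (p : C).

Local Notation FA := (free_alg C 'I_3).
Definition freeI : FA := free_gen C (@Ordinal 3 0 isT).
Definition freeT1 : FA := free_gen C (@Ordinal 3 1 isT).
Definition freeT2 : FA := free_gen C (@Ordinal 3 2 isT).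

Definition iso2_ideal : set FA :=
  smallest (@two_sided_ideal FA) (iso2_relators p freeI freeT1 freeT2).

Lemma iso2_ideal_min (J : set FA) :
  two_sided_ideal J -> iso2_relators p freeI freeT1 freeT2 `<=` J -> iso2_ideal `<=` J.
Proof. by move=> Ji Jr; exact: smallest_sub. Qed.

Lemma iso2_ideal_rel a :
  iso2_relators p freeI freeT1 freeT2 a -> iso2_ideal a.
Proof. by move=> ra J [_]; apply. Qed.

Lemma iso2_ideal_two_sided : two_sided_ideal iso2_ideal.
Proof.
split=> [|x y Jx Jy|a x Jx|a x Jx] J [Ji Jr]; have [J0 JD JMl JMr] := Ji => //.
- by apply: JD; [apply: Jx|apply: Jy].
- by apply: JMl; apply: Jx.
- by apply: JMr; apply: Jx.
Qed.

Lemma iso2_ideal_proper : ~ iso2_ideal 1.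
Proof.
pose J : set FA := [set a | mcoeff mone a = 0].
have M (a b : FA) : mcoeff mone (a * b) = mcoeff mone a * mcoeff mone b :> C.
  exact: rmorphM.
have g0 i : mcoeff mone (free_gen C i : FA) = 0 by rewrite mcoeffU1 fm1_eq1.
have Ji : two_sided_ideal J.
  split=> [|x y|a x|a x]; rewrite /J /= ?mcoeff0 //.
  - by rewrite mcoeffD => -> ->; rewrite addr0.
  - by rewrite M => ->; rewrite mulr0.
  - by rewrite M => ->; rewrite mul0r.
have Jr : iso2_relators p freeI freeT1 freeT2 `<=` J.
  have L : linear (mcoeff mone : FA -> C^o) by move=> c a b; exact: linearP.
  move=> a /(iso2_relators_morph L M); rewrite /J /freeI /freeT1 /freeT2 !g0.
  by case=> [[]|] /= H; rewrite [LHS]H !mulr0 !scaler0 ?subr0.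
move=> /(iso2_ideal_min Ji Jr); rewrite /J /= mcoeff1 eqxx.
by move/eqP; rewrite oner_eq0.
Qed.

Definition in_iso2_ideal (a : FA) : bool := `[< iso2_ideal a >].

Fact in_iso2_ideal_zmod_closed : zmod_closed in_iso2_ideal.
Proof.
have [J0 JD JMl _] := iso2_ideal_two_sided.
split=> [|x y]; first exact/asboolP.
move=> /asboolP Jx /asboolP Jy; apply/asboolP.
apply: (JD x (- y)) => //; have -> : - y = -1 * y by rewrite mulN1r.
exact: JMl.
Qed.
HB.instance Definition _ :=
  GRing.isZmodClosed.Build FA in_iso2_ideal in_iso2_ideal_zmod_closed.

Definition Uq_iso2 : Type := Quotient.quot (GRing.ZmodClosed.clone FA in_iso2_ideal _).
Local Notation U := Uq_iso2.

HB.instance Definition _ := GRing.Zmodule.on U.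
HB.instance Definition _ := EqQuotient.on U.

Definition Uq_one : U := \pi_U 1.
Definition Uq_mul (x y : U) : U := \pi_U (repr x * repr y).
Definition Uq_scale (c : C) (x : U) : U := \pi_U (c *: repr x).

Lemma Uq_piP (a b : FA) : \pi_U a = \pi_U b <-> iso2_ideal (a - b).
Proof.
split=> [/eqP|H]; last apply/eqP.
  by rewrite -Quotient.idealrBE => /asboolP.
by rewrite -Quotient.idealrBE; apply/asboolP.
Qed.


Lemma Uq_pi_one : \pi_U 1 = Uq_one. Proof. by []. Qed.

Lemma Uq_piD a b : \pi_U (a + b) = \pi_U a + \pi_U b.
Proof. exact: Quotient.pi_add. Qed.

Lemma Uq_pi_mul a b : \pi_U (a * b) = Uq_mul (\pi_U a) (\pi_U b).
Proof.
have [_ JD JMl JMr] := iso2_ideal_two_sided.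
have Ja : iso2_ideal (a - repr (\pi_U a)) by apply/Uq_piP; rewrite reprK.
have Jb : iso2_ideal (b - repr (\pi_U b)) by apply/Uq_piP; rewrite reprK.
apply/Uq_piP; set a' := repr _ in Ja *; set b' := repr _ in Jb *.
have -> : a * b - a' * b' = (a - a') * b + a' * (b - b').
  by rewrite mulrBl mulrBr addrA subrK.
by apply: JD; [exact: JMr|exact: JMl].
Qed.

Lemma Uq_pi_scale c a : \pi_U (c *: a) = Uq_scale c (\pi_U a).
Proof.
have [_ _ JMl _] := iso2_ideal_two_sided.
apply/Uq_piP; rewrite -scalerBr -mul_malgC; apply: JMl.
by apply/Uq_piP; rewrite reprK.
Qed.

Lemma Uq_surj (x : U) : {a : FA | x = \pi_U a}.
Proof. by exists (repr x); rewrite reprK. Qed.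

Fact Uq_mulA : associative Uq_mul.
Proof.
by move=> x y z; case: (Uq_surj x) (Uq_surj y) (Uq_surj z) => a -> [b ->] [d ->]; rewrite -!Uq_pi_mul mulrA.
Qed.
Fact Uq_mul1 : left_id Uq_one Uq_mul.
Proof. by move=> x; case: (Uq_surj x) => a ->; rewrite -Uq_pi_one -Uq_pi_mul mul1r. Qed.
Fact Uq_mulr1 : right_id Uq_one Uq_mul.
Proof. by move=> x; case: (Uq_surj x) => a ->; rewrite -Uq_pi_one -Uq_pi_mul mulr1. Qed.
Fact Uq_mulDl : left_distributive Uq_mul +%R.
Proof.
move=> x y z; case: (Uq_surj x) (Uq_surj y) (Uq_surj z) => a -> [b ->] [d ->].
by rewrite -Uq_piD -!Uq_pi_mul -Uq_piD mulrDl.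
Qed.
Fact Uq_mulDr : right_distributive Uq_mul +%R.
Proof.
move=> x y z; case: (Uq_surj x) (Uq_surj y) (Uq_surj z) => a -> [b ->] [d ->].
by rewrite -Uq_piD -!Uq_pi_mul -Uq_piD mulrDr.
Qed.
Fact Uq_one_neq0 : Uq_one != 0.
Proof.
apply/eqP=> H; apply: iso2_ideal_proper; rewrite -[1]subr0.
apply/Uq_piP; rewrite -[LHS]/Uq_one H.
by apply: (addrI (\pi_U 0)); rewrite -Uq_piD !addr0.
Qed.
HB.instance Definition _ := GRing.Zmodule_isNzRing.Build U
  Uq_mulA Uq_mul1 Uq_mulr1 Uq_mulDl Uq_mulDr Uq_one_neq0.

Fact Uq_scaleA a b (x : U) : Uq_scale a (Uq_scale b x) = Uq_scale (a * b) x.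
Proof. by case: (Uq_surj x) => d ->; rewrite -!Uq_pi_scale scalerA. Qed.
Fact Uq_scale1 : left_id 1 Uq_scale.
Proof. by move=> x; case: (Uq_surj x) => a ->; rewrite -Uq_pi_scale scale1r. Qed.
Fact Uq_scaleDr : right_distributive Uq_scale +%R.
Proof.
move=> c x y; case: (Uq_surj x) (Uq_surj y) => a -> [b ->]; rewrite -Uq_piD -!Uq_pi_scale -Uq_piD.
by rewrite scalerDr.
Qed.
Fact Uq_scaleDl x : {morph Uq_scale^~ x : a b / a + b}.
Proof.
by move=> a b; case: (Uq_surj x) => d ->; rewrite /= -!Uq_pi_scale -Uq_piD scalerDl.
Qed.
HB.instance Definition _ := GRing.Zmodule_isLmodule.Build C U
  Uq_scaleA Uq_scale1 Uq_scaleDr Uq_scaleDl.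

Fact Uq_scaleAl c (x y : U) : c *: (x * y) = c *: x * y.
Proof.
case: (Uq_surj x) (Uq_surj y) => a -> [b ->]; rewrite -[LHS]/(Uq_scale c (Uq_mul _ _)).
rewrite -[RHS]/(Uq_mul (Uq_scale c _) _).
by rewrite -Uq_pi_mul -!Uq_pi_scale -Uq_pi_mul scalerAl.
Qed.
HB.instance Definition _ := GRing.Lmodule_isLalgebra.Build C U Uq_scaleAl.

Fact Uq_scaleAr c (x y : U) : c *: (x * y) = x * (c *: y).
Proof.
case: (Uq_surj x) (Uq_surj y) => a -> [b ->]; rewrite -[LHS]/(Uq_scale c (Uq_mul _ _)).
rewrite -[RHS]/(Uq_mul _ (Uq_scale c _)).
by rewrite -Uq_pi_mul -!Uq_pi_scale -Uq_pi_mul scalerAr.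
Qed.
HB.instance Definition _ := GRing.Lalgebra_isAlgebra.Build C U Uq_scaleAr.

Fact Uq_pi_is_linear : linear (\pi_U : FA -> U).
Proof. by move=> c a b; rewrite Uq_piD Uq_pi_scale. Qed.
Fact Uq_pi_is_multiplicative : monoid_morphism (\pi_U : FA -> U).
Proof. by split=> [|a b]; rewrite ?Uq_pi_one ?Uq_pi_mul. Qed.

Definition Uq_I : U := \pi_U freeI.
Definition Uq_T1 : U := \pi_U freeT1.
Definition Uq_T2 : U := \pi_U freeT2.

Lemma Uq_pi0 : \pi_U 0 = 0.
Proof. by apply: (addrI (\pi_U 0)); rewrite -Uq_piD !addr0. Qed.

Lemma Uq_relations :
  [/\ p *: (Uq_I * Uq_T2) - p^-1 *: (Uq_T2 * Uq_I) = Uq_T1,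
      p *: (Uq_T1 * Uq_I) - p^-1 *: (Uq_I * Uq_T1) = Uq_T2
    & p *: (Uq_T2 * Uq_T1) - p^-1 *: (Uq_T1 * Uq_T2) = 0].
Proof.
have pi0 a : iso2_relators p freeI freeT1 freeT2 a -> \pi_U a = 0.
  by move=> ra; rewrite -Uq_pi0; apply/Uq_piP; rewrite subr0; exact: iso2_ideal_rel.
have piN a : \pi_U (- a) = - \pi_U a by exact: Quotient.pi_opp.
have piZ c a : \pi_U (c *: a) = c *: \pi_U a by exact: Uq_pi_scale.
have piM a b : \pi_U (a * b) = \pi_U a * \pi_U b by exact: Uq_pi_mul.
have E a b c : a - b - c = 0 -> a - b = c :> U by move=> /eqP; rewrite subr_eq0 => /eqP.
split; [apply: E|apply: E|]; rewrite /Uq_I /Uq_T1 /Uq_T2.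
- by rewrite -!piM -!piZ -!piN -!Uq_piD; apply: pi0; left; left.
- by rewrite -!piM -!piZ -!piN -!Uq_piD; apply: pi0; left; right.
- by rewrite -!piM -!piZ -!piN -!Uq_piD; apply: pi0; right.
Qed.

End Uq.

Arguments freeI {R}.
Arguments freeT1 {R}.
Arguments freeT2 {R}.

(* An algebra morphism A -> End(V), written as an action. *)
Record representation (F : fieldType) (A : algType F) (V : lmodType F) :=
  Representation {
    rep_act :> A -> V -> V;
    rep_linear : forall a, linear (rep_act a);
    rep_linear_l : forall v, linear (rep_act^~ v);
    rep_1 : forall v, rep_act 1 v = v;
    rep_M : forall a b v, rep_act (a * b) v = rep_act a (rep_act b v) }.

Section RepOfOperators.
Context (R : realType).
Local Notation C := R[i].
Context (p : C) (V : lmodType C) (XI X1 X2 : {linear V -> V}).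

Definition iso2_rel_holds :=
  [/\ forall v, p *: XI (X2 v) - p^-1 *: X2 (XI v) = X1 v,
      forall v, p *: X1 (XI v) - p^-1 *: XI (X1 v) = X2 v
    & forall v, p *: X2 (X1 v) - p^-1 *: X1 (X2 v) = 0].

Local Notation FA := (free_alg C 'I_3).
Definition gen_op (i : 'I_3) : V -> V :=
  match val i with 0 => XI | 1 => X1 | _ => X2 end.
Definition word_op (v : V) (w : {fmonom 'I_3}) : V := foldr gen_op v w.
Definition free_act (a : FA) (v : V) : V := lext (word_op v) a.

Fact free_act_linear_l v : linear (free_act^~ v).
Proof. exact: lext_is_linear. Qed.

Fact free_act_linear a : linear (free_act a).
Proof.
have gL i : linear (gen_op i) by case: i => [[|[|i]] ?]; exact: linearP.
have wL w : linear (word_op^~ w).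
  by move=> c u v; rewrite /word_op; elim: (w : seq _) => //= i s ->; exact: gL.
move=> c u v; rewrite /free_act /lext scaler_sumr -big_split /=.
by apply: eq_bigr => w _; rewrite wL scalerDr !scalerA mulrC.
Qed.

Fact free_act1 v : free_act 1 v = v.
Proof. by rewrite /free_act lextU /word_op fm1. Qed.

Fact free_actM a b v : free_act (a * b) v = free_act a (free_act b v).
Proof.
have lin c x y u : free_act (c *: x + y) u = c *: free_act x u + free_act y u.
  exact: free_act_linear_l.
have l0 x : free_act 0 x = 0 by exact: raddf0.
have r0 x : free_act x 0 = 0.
  by have := free_act_linear x (- 1) 0 0; rewrite scaler0 addr0 scaleN1r addNr.
move: a b v; apply: malg_lin_ind => [b v|c x y Px Py b v|w].
- by rewrite [0 * b]mul0r !l0.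
- have -> : (c *: x + y) * b = c *: (x * b : FA) + y * b :> FA.
    by rewrite mulrDl scalerAl.
  rewrite [LHS]lin [RHS]lin.
  by congr (_ *: _ + _); [exact: Px|exact: Py].
apply: malg_lin_ind => [v|c x y Px Py v|w' v].
- by rewrite [_ * 0]mulr0 l0 r0.
- have -> : << w >> * (c *: x + y) = c *: (<< w >> * x : FA) + << w >> * y :> FA.
    by rewrite mulrDr scalerAr.
  rewrite [LHS]lin (lin c x y v) [RHS]free_act_linear.
  by congr (_ *: _ + _); [exact: Px|exact: Py].
- by rewrite free_genM /free_act !lextU /word_op fmM foldr_cat.
Qed.

Hypothesis XP : iso2_rel_holds.

Fact free_act_ideal a v : iso2_ideal p a -> free_act a v = 0.
Proof.
pose J : set FA := [set a | forall v, free_act a v = 0].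
have r0 x : free_act x 0 = 0.
  by have := free_act_linear x (- 1) 0 0; rewrite scaler0 addr0 scaleN1r addNr.
have l0 x : free_act 0 x = 0 by exact: raddf0.
have lZ c x u : free_act (c *: x) u = c *: free_act x u by exact: linearZ.
have lB x y u : free_act (x - y) u = free_act x u - free_act y u by exact: raddfB.
have lD x y u : free_act (x + y) u = free_act x u + free_act y u by exact: raddfD.
have Ji : two_sided_ideal J.
  split=> [u|x y Jx Jy u|b x Jx u|b x Jx u]; rewrite ?l0 //.
  - by rewrite lD Jx Jy addr0.
  - by rewrite free_actM Jx.
  - by rewrite free_actM Jx.
have aI u : free_act freeI u = XI u by rewrite /free_act lextU /word_op fmuE.
have a1 u : free_act freeT1 u = X1 u by rewrite /free_act lextU /word_op fmuE.
have a2 u : free_act freeT2 u = X2 u by rewrite /free_act lextU /word_op fmuE.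
have aM c f g u : free_act (c *: (f * g)) u = c *: free_act f (free_act g u).
  by apply: etrans; [exact: lZ|congr (_ *: _); exact: free_actM].
have aM2 c d f g h k u : free_act (c *: (f * g) - d *: (h * k)) u =
    c *: free_act f (free_act g u) - d *: free_act h (free_act k u).
  by apply: etrans; [exact: lB|congr (_ - _); exact: aM].
have aM3 c d f g h k l u : free_act (c *: (f * g) - d *: (h * k) - l) u =
    c *: free_act f (free_act g u) - d *: free_act h (free_act k u) - free_act l u.
  by apply: etrans; [exact: lB|congr (_ - _); exact: aM2].
case: XP => r1 r2 r3.
suff Jr : iso2_relators p freeI freeT1 freeT2 `<=` J.
  by move=> /(iso2_ideal_min Ji Jr); exact.
move=> x [[]|] /= -> u.
- by rewrite (aM3 p p^-1 freeI freeT2 freeT2 freeI freeT1 u) !aI !a2 a1 r1 subrr.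
- by rewrite (aM3 p p^-1 freeT1 freeI freeI freeT1 freeT2 u) !aI !a1 a2 r2 subrr.
- by rewrite (aM2 p p^-1 freeT2 freeT1 freeT1 freeT2 u) !a1 !a2 r3.
Qed.

Definition Uq_act (a : Uq_iso2 p) (v : V) : V := free_act (repr a) v.

Fact Uq_act_pi a v : Uq_act (\pi_(Uq_iso2 p) a) v = free_act a v.
Proof.
have Ja : iso2_ideal p (a - repr (\pi_(Uq_iso2 p) a)) by apply/Uq_piP; rewrite reprK.
have lB x y u : free_act (x - y) u = free_act x u - free_act y u by exact: raddfB.
apply/esym/eqP; rewrite -subr_eq0 /Uq_act -lB; apply/eqP.
exact: free_act_ideal.
Qed.

Fact Uq_act_linear a : linear (Uq_act a).
Proof. exact: free_act_linear. Qed.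

Fact Uq_act_linear_l v : linear (Uq_act^~ v).
Proof.
move=> c x y; have [[a ->] [b ->]] := (Uq_surj x, Uq_surj y).
rewrite /= -[c *: _]Uq_pi_scale -Uq_piD !Uq_act_pi.
exact: free_act_linear_l.
Qed.

Fact Uq_act1 v : Uq_act 1 v = v.
Proof. by rewrite [LHS]Uq_act_pi free_act1. Qed.

Fact Uq_actM a b v : Uq_act (a * b) v = Uq_act a (Uq_act b v).
Proof.
have [[x ->] [y ->]] := (Uq_surj a, Uq_surj b).
by rewrite -[_ * _]Uq_pi_mul !Uq_act_pi free_actM.
Qed.

Definition rep_of_operators : representation (Uq_iso2 p) V :=
  Representation Uq_act_linear Uq_act_linear_l Uq_act1 Uq_actM.

Lemma rep_of_operatorsE :
  [/\ rep_of_operators (Uq_I p) =1 XI, rep_of_operators (Uq_T1 p) =1 X1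
    & rep_of_operators (Uq_T2 p) =1 X2].
Proof.
by split=> v; rewrite [LHS]Uq_act_pi /freeI /free_act lextU /word_op fmuE.
Qed.

End RepOfOperators.

Section Representations.
Context (F : fieldType) (A : algType F).

Definition subspace (V : lmodType F) (W : set V) :=
  W 0 /\ forall c u v, W u -> W v -> W (c *: u + v).

Definition invariant (V : lmodType F) (pi : representation A V) (W : set V) :=
  forall a v, W v -> W (pi a v).

Definition irreducible_rep (V : lmodType F) (pi : representation A V) :=
  forall W : set V, subspace W -> invariant pi W -> W = [set 0] \/ W = setT.

End Representations.

Section Equivalence.
Context (R : realType).
Local Notation C := R[i].

(* ||f||^2, with value +oo when f is not square-summable. *)
Definition l2_sqnorm (K : choiceType) (f : K -> C) : \bar R :=
  \esum_(k in [set: K]) (complex.Re (`|f k| ^+ 2))%:E.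

(* The Hilbert space with orthonormal basis indexed by K. The domain lin{|k>}
   is {malg C[K]}, embedded in it by v |-> (fun k => v@_k). *)
Definition l2 (K : choiceType) : set (K -> C) :=
  [set f | (l2_sqnorm f < +oo)%E].

Definition l2_dense (K : choiceType) (W : set {malg C[K]}) :=
  forall f, l2 f -> forall e : R, 0 < e ->
    exists2 w, W w & (l2_sqnorm (fun k => f k - w@_k)%R < (e ^+ 2)%:E)%E.

Definition equivalent_rep (A : algType C) (K K' : choiceType)
    (pi : representation A {malg C[K]}) (pi' : representation A {malg C[K']}) :=
  exists (W : set {malg C[K]}) (W' : set {malg C[K']})
         (T : {malg C[K]} -> {malg C[K']}),
    [/\ [/\ subspace W, invariant pi W & l2_dense W],
        [/\ subspace W', invariant pi' W' & l2_dense W'],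
        forall c u v, W u -> W v -> T (c *: u + v) = c *: T u + T v,
        set_bij W W' T
      & forall a v, W v -> T (pi a v) = pi' a (T v)].

End Equivalence.

Section Combinations.
Context (F : fieldType) (V : lmodType F) (p p' : F) (u v w : V).

Lemma comb2l a b a1 b1 k a' b' :
  p *: (a *: (a1 *: u) + b *: (b1 *: w)) - p' *: (k *: (a' *: u + b' *: w)) =
  (p * (a * a1) - p' * (k * a')) *: u + (p * (b * b1) - p' * (k * b')) *: w.
Proof. by rewrite !scalerDr !scalerA opprD addrACA !scalerBl !mulrA. Qed.

Lemma comb2r a b a1 b1 k a' b' :
  p *: (k *: (a' *: u + b' *: w)) - p' *: (a *: (a1 *: u) + b *: (b1 *: w)) =
  (p * (k * a') - p' * (a * a1)) *: u + (p * (k * b') - p' * (b * b1)) *: w.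
Proof. by rewrite !scalerDr !scalerA opprD addrACA !scalerBl !mulrA. Qed.

Lemma comb3 a b a1 a2 b1 b2 c d c1 c2 d1 d2 :
  p *: (a *: (a1 *: u + a2 *: v) + b *: (b1 *: v + b2 *: w)) -
  p' *: (c *: (c1 *: u + c2 *: v) + d *: (d1 *: v + d2 *: w)) =
  (p * (a * a1) - p' * (c * c1)) *: u +
  (p * (a * a2 + b * b1) - p' * (c * c2 + d * d1)) *: v +
  (p * (b * b2) - p' * (d * d2)) *: w.
Proof.
have E x y x1 x2 y1 y2 : x *: (x1 *: u + x2 *: v) + y *: (y1 *: v + y2 *: w) =
    (x * x1) *: u + (x * x2 + y * y1) *: v + (y * y2) *: w.
  by rewrite !scalerDr !scalerA scalerDl !addrA.
rewrite !E !scalerDr !scalerA !opprD addrACA [X in X + _ = _]addrACA.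
by rewrite !scalerBl.
Qed.

Lemma comb3l a b a1 a2 b1 b2 c d c1 c2 d1 d2 :
  p *: (a *: (a1 *: v + a2 *: u) + b *: (b1 *: w + b2 *: v)) -
  p' *: (c *: (c1 *: v + c2 *: u) + d *: (d1 *: w + d2 *: v)) =
  (p * (a * a2) - p' * (c * c2)) *: u +
  (p * (a * a1 + b * b2) - p' * (c * c1 + d * d2)) *: v +
  (p * (b * b1) - p' * (d * d1)) *: w.
Proof.
rewrite [a1 *: v + _]addrC [b1 *: w + _]addrC [c1 *: v + _]addrC.
by rewrite [d1 *: w + _]addrC comb3.
Qed.

Lemma comb3r a b a1 a2 b1 b2 c d c1 c2 d1 d2 :
  p *: (a *: (a1 *: u + a2 *: v) + b *: (b1 *: w + b2 *: v)) -
  p' *: (c *: (c1 *: u + c2 *: v) + d *: (d1 *: w + d2 *: v)) =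
  (p * (a * a1) - p' * (c * c1)) *: u +
  (p * (a * a2 + b * b2) - p' * (c * c2 + d * d2)) *: v +
  (p * (b * b1) - p' * (d * d1)) *: w.
Proof. by rewrite [b1 *: w + _]addrC [d1 *: w + _]addrC comb3. Qed.

End Combinations.

Section ConcreteRepresentations.
Context (R : realType).
Local Notation C := R[i].
Context (q p : C).

(* p is the fixed square root q^{1/2}. *)
Definition generic_q :=
  [/\ p ^+ 2 = q, q != 0 & forall n, (0 < n)%N -> ~~ n.-unity_root q].

Definition iso2_bracket (V : lmodType C) (f g : V -> V) (v : V) :=
  p *: f (g v) - p^-1 *: g (f v).

Lemma iso2_bracket_linear (V : lmodType C) (f g : V -> V) :
  linear f -> linear g -> linear (iso2_bracket f g).
Proof.
move=> fL gL c u v; rewrite /iso2_bracket !(fL, gL) !scalerDr !scalerN !scalerA.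
by rewrite !(mulrC c) opprD addrACA.
Qed.

Lemma iso2_rel_basis (K : choiceType) (XI X1 X2 : {linear {malg C[K]} -> {malg C[K]}}) :
  (forall k,
    [/\ p *: XI (X2 << k >>) - p^-1 *: X2 (XI << k >>) = X1 << k >>,
        p *: X1 (XI << k >>) - p^-1 *: XI (X1 << k >>) = X2 << k >>
      & p *: X2 (X1 << k >>) - p^-1 *: X1 (X2 << k >>) = 0]) ->
  iso2_rel_holds p XI X1 X2.
Proof.
move=> H.
have ext (f : {malg C[K]} -> {malg C[K]}) :
    linear f -> (forall k, f << k >> = 0) -> forall v, f v = 0.
  move=> fL f0; apply: malg_lin_ind => [|c u v Hu Hv|k]; last exact: f0.
    by have := fL (- 1) 0 0; rewrite scaler0 addr0 scaleN1r addNr.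
  by rewrite fL Hu Hv scaler0 addr0.
have ext2 (f g h : {linear {malg C[K]} -> {malg C[K]}}) :
    (forall k, p *: f (g << k >>) - p^-1 *: g (f << k >>) = h << k >>) ->
    forall v, p *: f (g v) - p^-1 *: g (f v) = h v.
  move=> fgh v; apply/eqP; rewrite -subr_eq0; apply/eqP.
  apply: (ext (fun v => iso2_bracket f g v - h v)) => [c a b|k].
    rewrite (iso2_bracket_linear (linearP f) (linearP g)) (linearP h).
    by rewrite opprD addrACA -scalerBr.
  by rewrite /iso2_bracket fgh subrr.
split; [apply: ext2 => k; by case: (H k)|apply: ext2 => k; by case: (H k)|].
apply: (ext (iso2_bracket X2 X1)) => [|k]; last by case: (H k).
by apply: iso2_bracket_linear; exact: linearP.
Qed.

Hypothesis qP : generic_q.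

Let q0 : q != 0. Proof. by case: qP. Qed.
Let pq : p ^+ 2 = q. Proof. by case: qP. Qed.
Let p0 : p != 0. Proof. by apply: contra_neq q0 => p_0; rewrite -pq p_0 expr0n. Qed.
Let qX n : (0 < n)%N -> q ^+ n != 1.
Proof. by case: qP => _ _ /(_ n) H /H; rewrite -unity_rootE. Qed.
Let qV : q - q^-1 != 0.
Proof.
apply: contraNneq (qX (isT : (0 < 2)%N)) => /eqP; rewrite subr_eq0 => /eqP h.
by rewrite expr2 {1}h mulVf.
Qed.

Section Rrs.
Context (r s : C).

Definition Rrs_I (m : int) : {malg C[int]} :=
  ('i * ((s * q ^ m - s^-1 * q ^ (- m)) / (q - q^-1))) *: << m >>.
Definition Rrs_T2 (m : int) : {malg C[int]} :=
  (r / (s * q ^ m + s^-1 * q ^ (- m))) *: (<< m + 1 >> + << m - 1 >>).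
Definition Rrs_T1 (m : int) : {malg C[int]} :=
  (('i * p * r) / (s * q ^ m + s^-1 * q ^ (- m))) *:
    ((s * q ^ m) *: << m + 1 >> - (s^-1 * q ^ (- m)) *: << m - 1 >>).

Definition regular_s :=
  s != 0 /\ forall n : int, s != 'i * q ^ n /\ s != - ('i * q ^ n).

Hypothesis sP : regular_s.

Let x (m : int) := s * q ^ m.
Let x0 m : x m != 0.
Proof. by rewrite mulf_neq0 ?expfz_neq0 //; case: sP. Qed.
Let xV m : s^-1 * q ^ (- m) = (x m)^-1.
Proof. by rewrite invfM invr_expz. Qed.
Let xS m : x (m + 1) = x m * q.
Proof. by rewrite /x expfzDr // expr1z mulrA. Qed.
Let xP m : x (m - 1) = x m / q.
Proof. by rewrite /x expfzDr // exprN1 mulrA. Qed.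
Let xD m : x m + (x m)^-1 != 0.
Proof.
apply/eqP => h; have /eqP : (x m - 'i) * (x m + 'i) = 0.
  rewrite -subr_sqr sqrCi opprK expr2 -(mulfV (x0 m)) -mulrDr h mulr0.
  done.
have [_ /(_ (- m)) [n1 n2]] := sP.
have sE : s = x m * q ^ (- m) by rewrite /x -mulrA -expfzDr // subrr expr0z mulr1.
rewrite mulf_eq0 subr_eq0 addr_eq0 => /orP[] /eqP xE.
  by move: n1; rewrite {1}sE xE eqxx.
by move: n2; rewrite {1}sE xE mulNr eqxx.
Qed.
Let xD' m : x m ^+ 2 + 1 != 0.
Proof.
apply: contra_neq (xD m) => h.
by apply: (mulfI (x0 m)); rewrite mulrDr mulfV ?x0 // mulr0.
Qed.

Lemma Rrs_rel : iso2_rel_holds p (lext Rrs_I) (lext Rrs_T1) (lext Rrs_T2).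
Proof.
have H (V : lmodType C) (e : int -> V) (XI X1 X2 : {linear V -> V}) :
    (forall m, XI (e m) = ('i * ((x m - (x m)^-1) / (q - q^-1))) *: e m) ->
    (forall m, X1 (e m) = (('i * p * r) / (x m + (x m)^-1)) *:
       (x m *: e (m + 1) - (x m)^-1 *: e (m - 1))) ->
    (forall m, X2 (e m) = (r / (x m + (x m)^-1)) *: (e (m + 1) + e (m - 1))) ->
    forall m,
    [/\ p *: XI (X2 (e m)) - p^-1 *: X2 (XI (e m)) = X1 (e m),
        p *: X1 (XI (e m)) - p^-1 *: XI (X1 (e m)) = X2 (e m)
      & p *: X2 (X1 (e m)) - p^-1 *: X1 (X2 (e m)) = 0].
  move=> hI h1 h2 m.
  pose b m := r / (x m + (x m)^-1); pose c m := 'i * p * b m.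
  pose a m := 'i * ((x m - (x m)^-1) / (q - q^-1)).
  have {}hI k : XI (e k) = a k *: e k by rewrite hI.
  have {}h1 k : X1 (e k) = (c k * x k) *: e (k + 1) + (- (c k / x k)) *: e (k - 1).
    by rewrite h1 scalerBr !scalerA scaleNr /c /b !mulrA.
  have {}h2 k : X2 (e k) = b k *: e (k + 1) + b k *: e (k - 1).
    by rewrite h2 scalerDr.
  have i2 : 'i ^+ 2 = -1 :> C := sqrCi C.
  have lin (X : {linear V -> V}) a1 a2 u1 u2 :
      X (a1 *: u1 + a2 *: u2) = a1 *: X u1 + a2 *: X u2.
    by rewrite linearD !linearZ.
  have linZ (X : {linear V -> V}) a1 u1 : X (a1 *: u1) = a1 *: X u1 by rewrite linearZ.
  have [qV' xm d0 d1 d2] :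
    [/\ q ^+ 2 - 1 != 0, x m != 0, x m ^+ 2 + 1 != 0,
        (x m * q) ^+ 2 + 1 != 0 & (x m / q) ^+ 2 + 1 != 0].
    by rewrite subr_eq0 qX // x0 -xS -xP !xD'.
  have d2' : x m ^+ 2 + q ^+ 2 != 0.
    apply: contra_neq d2 => h; rewrite expr_div_n.
    by apply: (mulIf (expf_neq0 2 q0)); rewrite mulrDl mul1r divfK ?expf_neq0 // h mul0r.
  have qVE : q^-1 = p^-1 * p^-1 by rewrite -pq expr2 invfM.
  split.
  - rewrite hI h2 (lin XI) (linZ X2) h2 !hI h1 comb2l.
    by congr (_ *: _ + _ *: _); rewrite /c /b /a ?(xS, xP) -pq; field;
      rewrite -!expr2 pq xm d0 p0.
  - rewrite hI h1 (lin XI) (linZ X1) h1 !hI h2 comb2r.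
    by congr (_ *: _ + _ *: _); rewrite /c /b /a ?(xS, xP) -pq; field: i2;
      rewrite -!expr2 pq xm d0 p0.
  - have mm : m + 1 - 1 = m :> int by rewrite addrK.
    have mm' : m - 1 + 1 = m :> int by rewrite subrK.
    rewrite h1 h2 (lin X1) (lin X2) !h1 !h2 mm mm' comb3.
    have -> : p * (c m * x m * b (m + 1)) -
        p^-1 * (b m * (c (m + 1) * x (m + 1))) = 0.
      by rewrite /c xS -pq; field; rewrite p0.
    have -> : p * (- (c m / x m) * b (m - 1)) -
        p^-1 * (b m * - (c (m - 1) / x (m - 1))) = 0.
      by rewrite /c xP -pq; field; rewrite p0 xm.
    have -> : p * (c m * x m * b (m + 1) + - (c m / x m) * b (m - 1)) -
        p^-1 * (b m * - (c (m + 1) / x (m + 1)) + b m * (c (m - 1) * x (m - 1))) = 0.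
      by rewrite /c /b !xS !xP -pq; field; rewrite -!expr2 pq xm d0 p0 d2' d1.
    by rewrite !scale0r !addr0.
have hI k : lext Rrs_I << k >> =
    ('i * ((x k - (x k)^-1) / (q - q^-1))) *: << k >>.
  by rewrite lextU /Rrs_I xV.
have h1 k : lext Rrs_T1 << k >> = (('i * p * r) / (x k + (x k)^-1)) *:
    (x k *: << k + 1 >> - (x k)^-1 *: << k - 1 >>).
  by rewrite lextU /Rrs_T1 xV.
have h2 k : lext Rrs_T2 << k >> =
    (r / (x k + (x k)^-1)) *: (<< k + 1 >> + << k - 1 >>).
  by rewrite lextU /Rrs_T2 xV.
exact: iso2_rel_basis (H _ _ _ _ _ hI h1 h2).
Qed.

Definition Rrs : representation (Uq_iso2 p) {malg C[int]} :=
  rep_of_operators Rrs_rel.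

Lemma RrsE m :
  [/\ Rrs (Uq_I p) << m >> = Rrs_I m, Rrs (Uq_T1 p) << m >> = Rrs_T1 m
    & Rrs (Uq_T2 p) << m >> = Rrs_T2 m].
Proof.
have [hI h1 h2] := rep_of_operatorsE Rrs_rel.
split; [exact: (etrans (hI _) (lextU _ _))|exact: (etrans (h1 _) (lextU _ _))|].
exact: (etrans (h2 _) (lextU _ _)).
Qed.

End Rrs.

(* R_r^{eps,eps'}, where eps' is the second sign, epsilon-tilde. *)
Section Rdisc.
Context (r eps eps' : C).

(* q^{j+1/2} *)
Definition qhalf (j : nat) : C := q ^+ j * p.

Definition Rdisc_I (j : nat) : {malg C[nat]} :=
  (- (eps * ((qhalf j + (qhalf j)^-1) / (q - q^-1)))) *: << j >>.
Definition Rdisc_T2 (j : nat) : {malg C[nat]} :=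
  if j is k.+1 then
    (- (eps * ('i * r / (qhalf j - (qhalf j)^-1)))) *: (<< j.+1 >> + << k >>)
  else
    (- (eps * (r / (p - p^-1)))) *: (eps' *: << 0%N >> + 'i *: << 1%N >>).
Definition Rdisc_T1 (j : nat) : {malg C[nat]} :=
  if j is k.+1 then
    ('i * r / (qhalf j - (qhalf j)^-1)) *:
      (q ^+ j.+1 *: << j.+1 >> + q ^- j *: << k >>)
  else
    (r / (p - p^-1)) *: (eps' *: << 0%N >> + ('i * q) *: << 1%N >>).

Definition is_sign (e : C) := e = 1 \/ e = -1.

Hypotheses (epsP : is_sign eps) (eps'P : is_sign eps').

Let sign2 e : is_sign e -> e ^+ 2 = 1.
Proof. by case=> ->; rewrite ?sqrrN expr1n. Qed.
Let h0 j : qhalf j != 0.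
Proof. by rewrite mulf_neq0 ?expf_neq0. Qed.
Let hS j : qhalf j.+1 = qhalf j * q.
Proof. by rewrite /qhalf exprSr mulrAC. Qed.
Let hh j : qhalf j ^+ 2 = q ^+ j.*2.+1.
Proof. by rewrite exprMn pq -exprM muln2 exprSr. Qed.
Let hh_1 j : qhalf j ^+ 2 - 1 != 0.
Proof. by rewrite hh subr_eq0 qX. Qed.

Lemma Rdisc_rel : iso2_rel_holds p (lext Rdisc_I) (lext Rdisc_T1) (lext Rdisc_T2).
Proof.
have e2 := sign2 epsP; have e2' := sign2 eps'P.
have i2 : 'i ^+ 2 = -1 :> C := sqrCi C.
have H (V : lmodType C) (e : nat -> V) (XI X1 X2 : {linear V -> V}) :
    (forall j, XI (e j) = (- (eps * ((qhalf j + (qhalf j)^-1) / (q - q^-1)))) *: e j) ->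
    (X1 (e 0) = (r / (p - p^-1)) *: (eps' *: e 0 + ('i * q) *: e 1)) ->
    (forall k, X1 (e k.+1) = ('i * r / (qhalf k.+1 - (qhalf k.+1)^-1)) *:
      (q ^+ k.+2 *: e k.+2 + q ^- k.+1 *: e k)) ->
    (X2 (e 0) = (- (eps * (r / (p - p^-1)))) *: (eps' *: e 0 + 'i *: e 1)) ->
    (forall k, X2 (e k.+1) = (- (eps * ('i * r / (qhalf k.+1 - (qhalf k.+1)^-1)))) *:
      (e k.+2 + e k)) ->
    forall j,
    [/\ p *: XI (X2 (e j)) - p^-1 *: X2 (XI (e j)) = X1 (e j),
        p *: X1 (XI (e j)) - p^-1 *: XI (X1 (e j)) = X2 (e j)
      & p *: X2 (X1 (e j)) - p^-1 *: X1 (X2 (e j)) = 0].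
  move=> hI h10 h1S h20 h2S j.
  pose a j := - (eps * ((qhalf j + (qhalf j)^-1) / (q - q^-1))).
  pose b j := r / (qhalf j - (qhalf j)^-1).
  have q00 : qhalf 0 = p by rewrite /qhalf mul1r.
  have {}hI k : XI (e k) = a k *: e k by rewrite hI.
  have {}h10 : X1 (e 0) = (b 0 * eps') *: e 0 + (b 0 * 'i * q) *: e 1.
    by rewrite h10 scalerDr !scalerA /b q00 !mulrA.
  have {}h1S k : X1 (e k.+1) = ('i * b k.+1 * (qhalf k.+1 * q / p)) *: e k.+2 +
      ('i * b k.+1 * (p / qhalf k.+1)) *: e k.
    have hq : q ^+ k.+2 = qhalf k.+1 * q / p by rewrite /qhalf exprSr mulrAC mulfK.
    have hq' : q ^- k.+1 = p / qhalf k.+1.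
      by rewrite /qhalf invfM mulrCA mulfV // mulr1.
    by rewrite h1S hq hq' scalerDr !scalerA /b !mulrA.
  have {}h20 : X2 (e 0) = (- eps * b 0 * eps') *: e 0 + (- eps * b 0 * 'i) *: e 1.
    by rewrite h20 scalerDr !scalerA /b q00 !mulNr !mulrA.
  have {}h2S k : X2 (e k.+1) = (- eps * 'i * b k.+1) *: e k.+2 +
      (- eps * 'i * b k.+1) *: e k.
    by rewrite h2S scalerDr /b !mulNr !mulrA.
  have lin (X : {linear V -> V}) a1 a2 u1 u2 :
      X (a1 *: u1 + a2 *: u2) = a1 *: X u1 + a2 *: X u2.
    by rewrite linearD !linearZ.
  have linZ (X : {linear V -> V}) a1 u1 : X (a1 *: u1) = a1 *: X u1 by rewrite linearZ.
  have qV' : q ^+ 2 - 1 != 0 by rewrite subr_eq0 qX.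
  have p21 : p ^+ 2 - 1 != 0 by rewrite pq subr_eq0 -[q]expr1 qX.
  have q21 : q - 1 != 0 by rewrite -pq.
  have pq1 : (p * q) ^+ 2 - 1 != 0 by rewrite -q00 -hS hh_1.
  have pq2 : (p * q * q) ^+ 2 - 1 != 0 by rewrite -q00 -!hS hh_1.
  have coef0 (c1 c2 c3 : C) (u v w : V) : c1 = 0 -> c2 = 0 -> c3 = 0 ->
      c1 *: u + c2 *: v + c3 *: w = 0.
    by move=> -> -> ->; rewrite !scale0r !addr0.
  case: j => [|j]; split.
  - rewrite hI h20 (lin XI) (linZ X2) h20 !hI h10 comb2l.
    by congr (_ *: _ + _ *: _); rewrite /b /a ?hS q00 -pq; field: e2;
      rewrite -!expr2 p0 p21 pq.
  - rewrite hI h10 (lin XI) (linZ X1) h10 !hI h20 comb2r.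
    by congr (_ *: _ + _ *: _); rewrite /b /a ?hS q00 -pq; field: e2 i2;
      rewrite -!expr2 p0 p21 pq.
  - rewrite h10 h20 (lin X1) (lin X2) h10 h20 h1S h2S comb3l.
    by apply: coef0; rewrite /b ?hS q00 -pq; field: e2' i2; rewrite -!expr2 !pq p0 ?q21 ?pq1 ?pq2.
  - rewrite hI h2S (lin XI) (linZ X2) h2S !hI h1S comb2l.
    by congr (_ *: _ + _ *: _); rewrite /b /a ?hS -pq; field: e2;
      rewrite -!expr2 !pq -hS p0 h0 hh_1.
  - rewrite hI h1S (lin XI) (linZ X1) h1S !hI h2S comb2r.
    by congr (_ *: _ + _ *: _); rewrite /b /a ?hS -pq; field: i2;
      rewrite -!expr2 !pq -hS p0 h0 hh_1.
  - rewrite h1S h2S (lin X1) (lin X2); case: j => [|j].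
      rewrite h10 h20 !h1S !h2S comb3r.
      by apply: coef0; rewrite /b ?hS q00 -pq; field: e2' i2; rewrite -!expr2 !pq p0 ?q21 ?pq1 ?pq2.
    rewrite !h1S !h2S comb3.
    by apply: coef0; rewrite /b ?hS -pq; field: i2; rewrite -!expr2 !pq -!hS p0 h0 !hh_1.
have hI k : lext Rdisc_I << k >> =
    (- (eps * ((qhalf k + (qhalf k)^-1) / (q - q^-1)))) *: << k >>.
  exact: lextU.
have h10 := lextU Rdisc_T1 0%N; have h20 := lextU Rdisc_T2 0%N.
have h1S k := lextU Rdisc_T1 k.+1; have h2S k := lextU Rdisc_T2 k.+1.
exact: iso2_rel_basis (H _ (fun k => << k >>) _ _ _ hI h10 h1S h20 h2S).
Qed.

Definition Rdisc : representation (Uq_iso2 p) {malg C[nat]} :=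
  rep_of_operators Rdisc_rel.

Lemma RdiscE j :
  [/\ Rdisc (Uq_I p) << j >> = Rdisc_I j, Rdisc (Uq_T1 p) << j >> = Rdisc_T1 j
    & Rdisc (Uq_T2 p) << j >> = Rdisc_T2 j].
Proof.
have [hI h1 h2] := rep_of_operatorsE Rdisc_rel.
split; [exact: (etrans (hI _) (lextU _ _))|exact: (etrans (h1 _) (lextU _ _))|].
exact: (etrans (h2 _) (lextU _ _)).
Qed.

End Rdisc.
End ConcreteRepresentations.

Arguments Rrs {R q p} qP r s sP.
Arguments Rdisc {R q p} qP r eps eps' epsP eps'P.

(* Main.v *)
Require Import Defs.
From mathcomp Require Import all_boot all_order all_algebra complex.
From mathcomp Require Import reals.
From mathcomp Require Import finmap.
From mathcomp.multinomials Require Import monalg.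
From mathcomp Require Import classical_sets boolp ereal esum.
From mathcomp Require Import ring zify.

Set Implicit Arguments.
Unset Strict Implicit.
Unset Printing Implicit Defensive.

Import Order.TTheory GRing.Theory Num.Theory.
Local Open Scope ring_scope.

(** The operator [I] is diagonal in the given basis of each representation.
    In the discrete representations its eigenvalues are pairwise distinct: up
    to a common factor they are the numbers [eps * (x + x^-1)] with
    [x = q^(j+1/2)]; the squares [x ^+ 2] are odd powers of [q], and [q] is not
    a root of unity, so such a number determines both [eps] and [j]
    ([sign_qhalf_inj]).

    Irreducibility.  Because the spectrum of [I] is simple, an invariant
    subspace that contains a vector [v] contains every basis vector of the
    support of [v] ([invariant_basis]).  Applying [T2] to such a basis vector
    reaches its neighbours, hence the whole basis ([Rdisc_irreducible]).

    Nonequivalence.  A dense subspace is nonzero, so for an irreducible first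
    representation an equivalence is defined on the whole domain and is an
    injective intertwiner there ([equivalent_intertwiner]).  It sends
    eigenvectors of [I] to eigenvectors of [I] with the same eigenvalue.
    Between two discrete representations the eigenvalue of the vector [0]
    forces equality of the signs [eps] and sends the vector [0] to a multiple
    of itself; the diagonal entry of [T2] at [0] then yields
    [r * teps = r' * teps'], and positivity of the real parts separates [r] from
    the sign.  Towards [R_rs], an eigenvalue of [I] that occurs on both
    sides would mean [z + z^-1 = - eps * (p + p^-1)] for [z = 'i * s * q ^ m],
    i.e. [z = - eps * p] or [z = - eps / p], and these are exactly the
    excluded values of [s]. *)

(** * Representations with a diagonal operator *)

Lemma linear_fun0 (F : pzRingType) (U V : lmodType F) (f : U -> V) :
  linear f -> f 0 = 0.
Proof.
by move=> fL; have := fL (- 1) 0 0; rewrite scaler0 addr0 scaleN1r addNr.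
Qed.

Lemma linear_funZ (F : pzRingType) (U V : lmodType F) (f : U -> V) :
  linear f -> forall c v, f (c *: v) = c *: f v.
Proof.
by move=> fL c v; have := fL c v 0; rewrite (linear_fun0 fL) !addr0.
Qed.

Section Coefficients.
Context (F : fieldType) (K K' : choiceType).

Lemma mcoeff_comb2 (c a b : F) (i j k : K) :
  (c *: (a *: << i >> + b *: << j >>))@_k =
  c * (a * (i == k)%:R + b * (j == k)%:R).
Proof. by rewrite mcoeffZ mcoeffD !mcoeffZ !mcoeffU. Qed.

Lemma mcoeff_sum2 (c : F) (i j k : K) :
  (c *: (<< i >> + << j >>))@_k = c * ((i == k)%:R + (j == k)%:R).
Proof. by rewrite mcoeffZ mcoeffD !mcoeffU. Qed.

Lemma mcoeff_lin_ext (f : {malg F[K]} -> {malg F[K']}) c j j' :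
  linear f -> (forall k, (f << k >>)@_j = c * << k >>@_j') ->
  forall v, (f v)@_j = c * v@_j'.
Proof.
move=> fL fU; elim/malg_lin_ind => [|a u v IHu IHv|//].
  by rewrite (linear_fun0 fL) !mcoeff0 mulr0.
by rewrite fL !mcoeffD !mcoeffZ IHu IHv mulrDr mulrCA.
Qed.

Lemma malg_neq0 (v : {malg F[K]}) : v != 0 -> exists k, v@_k != 0.
Proof.
move=> v0; apply: contrapT => nz; move/eqP: v0; apply; apply/malgP => k.
by rewrite mcoeff0; apply/eqP; apply: contrapT => /negP vk; apply: nz; exists k.
Qed.

Lemma malgU_neq0 (k : K) : << k >> != 0 :> {malg F[K]}.
Proof.
by apply/eqP => /malgP/(_ k)/eqP; rewrite mcoeffUU mcoeff0 oner_eq0.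
Qed.

Lemma subspace_full (W : set {malg F[K]}) :
  Defs.subspace W -> (forall k, W << k >>) -> W = setT.
Proof.
move=> [W0 WL] Wk; rewrite -subTset => v _.
by elim/malg_lin_ind: v => // c u v; exact: WL.
Qed.

End Coefficients.

Section DiagonalOperator.
Context (F : fieldType) (A : algType F) (K : choiceType).
Context (pi : representation A {malg F[K]}) (a : A) (lam : K -> F).
Hypothesis pi_diag : forall k, pi a << k >> = lam k *: << k >>.

Lemma mcoeff_diag v k : (pi a v)@_k = lam k * v@_k.
Proof.
apply: (mcoeff_lin_ext (rep_linear pi a)) => j.
by rewrite pi_diag mcoeffZ mcoeffU; case: eqP => [->|] //; rewrite !mulr0.
Qed.

Lemma eigenvalue_in_diag v mu : v != 0 -> pi a v = mu *: v ->
  exists2 k, v@_k != 0 & mu = lam k.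
Proof.
move=> /malg_neq0[k vk] ev; exists k => //; apply: (mulIf vk).
by rewrite -mcoeff_diag ev mcoeffZ.
Qed.

Hypothesis lam_inj : injective lam.

(** Applying the product of the operators [pi a - lam j], over the other
    elements [j] of the support of [v], kills all components but one. *)
Lemma invariant_basis (W : set {malg F[K]}) v k :
  Defs.subspace W -> Defs.invariant pi W -> W v -> v@_k != 0 -> W << k >>.
Proof.
move=> [W0 WL] Winv Wv vk.
have shift (s : seq K) : exists2 w, W w &
    forall j, w@_j = v@_j * \prod_(i <- s) (lam j - lam i).
  elim: s => [|i s [w Ww wE]].
    by exists v => // j; rewrite big_nil mulr1.
  exists ((- lam i) *: w + pi a w); first by apply: WL => //; exact: Winv.
  by move=> j; rewrite mcoeffD mcoeffZ mcoeff_diag big_cons wE; ring.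
have [w Ww wE] := shift [seq i <- msupp v | i != k].
pose c := v@_k * \prod_(i <- [seq i <- msupp v | i != k]) (lam k - lam i).
have c0 : c != 0.
  rewrite mulf_neq0 // big_filter prodf_seq_neq0; apply/allP => i _.
  by apply/implyP; rewrite subr_eq0 (inj_eq lam_inj) eq_sym.
suff wk : w = c *: << k >>.
  have -> : << k >> = c^-1 *: w + 0 :> {malg F[K]}.
    by rewrite wk addr0 scalerA mulVf // scale1r.
  exact: WL.
apply/malgP => j; rewrite mcoeffZ mcoeffU wE; case: eqVneq => [<-|jk].
  by rewrite mulr1.
rewrite mulr0; have [jv|/mcoeff_outdom ->] := boolP (j \in msupp v); last first.
  by rewrite mul0r.
apply/eqP; rewrite mulf_eq0; apply/orP; right.
rewrite prodf_seq_eq0; apply/hasP; exists j => /=.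
  by rewrite mem_filter eq_sym jk.
by rewrite subrr.
Qed.

End DiagonalOperator.

(** * Equivalences of irreducible representations *)

Section Intertwiners.
Context (R : realType).
Local Notation C := R[i].

(** The zero vector is at distance 1 from each basis vector. *)
Lemma l2_dense_neq0 (K : choiceType) (k : K) (W : set {malg C[K]}) :
  l2_dense W -> W <> [set 0]%classic.
Proof.
move=> dW W0; pose f (i : K) : C := (i == k)%:R.
have f1 : l2_sqnorm f = 1%:E.
  have -> : l2_sqnorm f = (\esum_(i in [set k]%classic) (1%:E : \bar R))%E.
    rewrite esum_mkcond; apply: eq_esum => i _.
    rewrite /f; have [->|ik] := eqVneq i k.
      by rewrite mem_set // normr1 expr1n.
    by rewrite memNset ?normr0 ?expr0n // => /eqP; exact/negP.
  by rewrite esum_set1 // lee_fin.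
have [|w Ww] := dW f _ 1 ltr01; first by rewrite /l2 /= f1 ltry.
move: Ww; rewrite W0 /= => ->.
have -> : (fun i => f i - (0 : {malg C[K]})@_i) = f.
  by apply/funext => i; rewrite mcoeff0 subr0.
by rewrite f1 expr1n ltxx.
Qed.

(** The equivalence lives on a dense invariant subspace, which irreducibility
    forces to be the whole domain; [k] only witnesses that the basis is not
    empty, so that density excludes the zero subspace. *)
Lemma equivalent_intertwiner (A : algType C) (K K' : choiceType) (k : K)
    (pi : representation A {malg C[K]}) (pi' : representation A {malg C[K']}) :
  irreducible_rep pi -> equivalent_rep pi pi' ->
  exists T : {malg C[K]} -> {malg C[K']},
    [/\ linear T, forall v, v != 0 -> T v != 0
      & forall a v, T (pi a v) = pi' a (T v)].
Proof.
move=> irr [W [W' [T [[sW iW dW] _ TL [_ Tinj _] TM]]]].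
have [/(l2_dense_neq0 k dW)//|WT] := irr _ sW iW; subst W.
have {}TL : linear T by move=> c u v; exact: TL.
have T0 := linear_fun0 TL.
exists T; split=> [//|v|a v]; last exact: TM.
by apply: contra_neq => Tv0; apply: Tinj; rewrite ?inE // T0.
Qed.

End Intertwiners.

(** * The spectrum of I in the discrete representations *)

Section Spectrum.
Context (R : realType).
Local Notation C := R[i].
Context (q p : C).
Hypothesis qP : generic_q q p.

Lemma generic_q_neq0 : q != 0.
Proof. by case: qP. Qed.

Lemma generic_p_neq0 : p != 0.
Proof. by case: qP => pq q0 _; apply: contra_neq q0 => p0; rewrite -pq p0 expr0n. Qed.

Lemma generic_qX n : (0 < n)%N -> q ^+ n != 1.
Proof. by case: qP => _ _ /(_ n) H /H; rewrite -unity_rootE. Qed.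

Lemma generic_qX_inj : injective (fun n => q ^+ n).
Proof.
move=> m n; wlog le_mn : m n / (m <= n)%N.
  by move=> H; case: (leqP m n) => [|/ltnW] le e; [|apply/esym]; exact: H.
move=> /eqP; rewrite -(subnKC le_mn) exprD -[X in X == _]mulr1.
rewrite (inj_eq (mulfI (expf_neq0 _ generic_q_neq0))).
case: (n - m)%N => [|d]; first by rewrite addn0.
by rewrite eq_sym (negPf (generic_qX _)).
Qed.

Lemma generic_qBV : q - q^-1 != 0.
Proof.
apply: contraNneq (generic_qX (isT : (0 < 2)%N)) => /eqP.
by rewrite subr_eq0 expr2 => /eqP {1}->; rewrite mulVf ?generic_q_neq0.
Qed.

Lemma qhalf_neq0 j : qhalf q p j != 0.
Proof. by rewrite mulf_neq0 ?expf_neq0 ?generic_q_neq0 ?generic_p_neq0. Qed.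

Lemma qhalf_sqr j : qhalf q p j ^+ 2 = q ^+ j.*2.+1.
Proof. by case: qP => pq _ _; rewrite exprMn pq -exprM muln2 exprSr. Qed.

Lemma qhalfBV_neq0 j : qhalf q p j - (qhalf q p j)^-1 != 0.
Proof.
apply: contraNneq (generic_qX (isT : (0 < j.*2.+1)%N)) => /eqP.
by rewrite subr_eq0 -qhalf_sqr expr2 => /eqP {1}->; rewrite mulVf ?qhalf_neq0.
Qed.

Lemma sign_sqr (e : C) : is_sign e -> e ^+ 2 = 1.
Proof. by case=> ->; rewrite ?sqrrN expr1n. Qed.

(** Squaring removes the signs; [x ^+ 2 + x ^- 2 = y ^+ 2 + y ^- 2] then
    leaves [x ^+ 2 = y ^+ 2] or [x ^+ 2 * y ^+ 2 = 1], and the latter would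
    make a positive power of [q] equal to 1. *)
Lemma sign_qhalf_inj (e e' : C) j k : is_sign e -> is_sign e' ->
  e * (qhalf q p j + (qhalf q p j)^-1) = e' * (qhalf q p k + (qhalf q p k)^-1) ->
  e = e' /\ j = k.
Proof.
move=> /sign_sqr e2 /sign_sqr e2' eqw.
have x0 := qhalf_neq0 j; have y0 := qhalf_neq0 k.
have jk : j = k.
  have sq (x y : C) : x != 0 -> y != 0 -> e * (x + x^-1) = e' * (y + y^-1) ->
      (x ^+ 2 - y ^+ 2) * (x ^+ 2 * y ^+ 2 - 1) = 0.
    move=> x_neq0 y_neq0 /(congr1 (fun z => z ^+ 2)).
    rewrite /= !exprMn e2 e2' !mul1r => xy.
    transitivity (x ^+ 2 * y ^+ 2 * ((x + x^-1) ^+ 2 - (y + y^-1) ^+ 2)).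
      by field; rewrite x_neq0 y_neq0.
    by rewrite xy subrr mulr0.
  have := sq _ _ x0 y0 eqw.
  move/eqP; rewrite !qhalf_sqr -exprD mulf_eq0 !subr_eq0 => /orP[/eqP|].
    by move/generic_qX_inj => -[]; exact: double_inj.
  by rewrite (negPf (generic_qX _)).
split=> //; move: eqw; rewrite -jk; apply: mulIf.
apply: contraNneq (generic_qX (isT : (0 < j.*2.+1 * 2)%N)) => xx.
rewrite exprM -qhalf_sqr; apply/eqP.
have -> : qhalf q p j ^+ 2 = -1.
  apply/eqP; rewrite -addr_eq0; apply/eqP.
  by rewrite -(mulfV x0) expr2 -mulrDr xx mulr0.
by rewrite sqrrN expr1n.
Qed.

Definition disc_weight (e : C) (j : nat) : C :=
  - (e * ((qhalf q p j + (qhalf q p j)^-1) / (q - q^-1))).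

Lemma disc_weight_inj2 (e e' : C) j k : is_sign e -> is_sign e' ->
  disc_weight e j = disc_weight e' k -> e = e' /\ j = k.
Proof.
move=> he he' /oppr_inj; rewrite !mulrA => /(mulIf (invr_neq0 generic_qBV)).
exact: sign_qhalf_inj.
Qed.

Lemma disc_weight_inj e : is_sign e -> injective (disc_weight e).
Proof. by move=> he j k /(disc_weight_inj2 he he)[]. Qed.

(** * Irreducibility of the discrete representations *)

Section Discrete.
Context (r eps teps : C) (heps : is_sign eps) (hteps : is_sign teps).
Local Notation pi := (Rdisc qP r eps teps heps hteps).

Lemma Rdisc_I_diag k : pi (Uq_I p) << k >> = disc_weight eps k *: << k >>.
Proof. by case: (RdiscE qP r heps hteps k). Qed.

Lemma sign_neq0 (e : C) : is_sign e -> e != 0.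
Proof. by case=> ->; rewrite ?oppr_eq0 oner_eq0. Qed.


Lemma Rdisc_T2_up k : r != 0 -> (pi (Uq_T2 p) << k >>)@_k.+1 != 0.
Proof.
have e0 := sign_neq0 heps; have hk := qhalfBV_neq0 k => r0.
case: (RdiscE qP r heps hteps k) => _ _ ->.
case: k hk => [|k] hk; rewrite /Rdisc_T2.
  rewrite /qhalf expr0 mul1r in hk.
  rewrite [X in X != 0]mcoeff_comb2 /= mulr0 add0r mulr1.
  by rewrite mulf_neq0 ?neq0Ci // oppr_eq0 mulf_neq0 // mulf_neq0 ?invr_neq0.
rewrite [X in X != 0]mcoeff_sum2 eqxx (_ : (k == k.+2) = false); last first.
  by apply/negP; lia.
rewrite addr0 mulr1 oppr_eq0 mulf_neq0 // mulf_neq0 ?invr_neq0 //.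
by rewrite mulf_neq0 ?neq0Ci.
Qed.

Lemma Rdisc_T2_down k : r != 0 -> (pi (Uq_T2 p) << k.+1 >>)@_k != 0.
Proof.
have e0 := sign_neq0 heps; have hk := qhalfBV_neq0 k.+1 => r0.
case: (RdiscE qP r heps hteps k.+1) => _ _ ->; rewrite /Rdisc_T2.
rewrite [X in X != 0]mcoeff_sum2 eqxx (_ : (k.+2 == k) = false); last first.
  by apply/negP; lia.
rewrite add0r mulr1 oppr_eq0 mulf_neq0 // mulf_neq0 ?invr_neq0 //.
by rewrite mulf_neq0 ?neq0Ci.
Qed.

(** In contrast with [Rdisc_I_diag], this entry sees [teps] and [r], and only
    through their product. *)
Lemma Rdisc_T2_00 :
  (pi (Uq_T2 p) << 0%N >>)@_0%N = - (eps * (r / (p - p^-1))) * teps.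
Proof.
case: (RdiscE qP r heps hteps 0) => _ _ ->; rewrite /Rdisc_T2.
by rewrite [LHS]mcoeff_comb2 /= mulr0 addr0 mulr1.
Qed.

(** The matrix of [T2] has nonzero entries just above and just below the
    diagonal, so one basis vector in an invariant subspace brings in its
    neighbours. *)
Lemma Rdisc_irreducible : r != 0 -> irreducible_rep pi.
Proof.
move=> r0 W sW iW.
have [[v Wv v0]|Wtriv] := pselect (exists2 v, W v & v != 0); last first.
  left; apply/seteqP; split=> [v Wv|v ->]; last by case: sW.
  by apply: contrapT => /eqP v0; apply: Wtriv; exists v.
right; apply: (subspace_full sW).
have spread u k : W u -> u@_k != 0 -> W << k >>.
  exact: (invariant_basis Rdisc_I_diag (disc_weight_inj heps) sW iW).
have [k vk] := malg_neq0 v0.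
have W0 : W << 0%N >>.
  have := spread _ _ Wv vk; elim: k {vk} => // k IH Wk; apply: IH.
  by apply: spread (iW (Uq_T2 p) _ Wk) _; exact: Rdisc_T2_down.
elim=> // j Wj.
by apply: spread (iW (Uq_T2 p) _ Wj) _; exact: Rdisc_T2_up.
Qed.

End Discrete.

(** * Nonequivalence *)

(** Two numbers in the right half-plane that agree up to sign are equal: the
    half-plane does not meet its opposite. *)
Lemma sign_Re_inj (r r' e e' : C) : is_sign e -> is_sign e' ->
  0 < complex.Re r -> 0 < complex.Re r' -> r * e = r' * e' ->
  e = e' /\ r = r'.
Proof.
have ReN (z : C) : complex.Re (- z) = - complex.Re z by case: z.
case=> -> [] -> rpos rpos'; rewrite ?mulr1 ?mulrN1.
- by [].
- move=> rE; move: rpos; rewrite rE ReN oppr_gt0.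
  by move=> /(lt_trans rpos'); rewrite ltxx.
- move=> rE; move: rpos'; rewrite -rE ReN oppr_gt0.
  by move=> /(lt_trans rpos); rewrite ltxx.
- by move/oppr_inj.
Qed.

Lemma Rdisc_nonequivalent (r r' eps teps eps' teps' : C)
    (heps : is_sign eps) (hteps : is_sign teps)
    (heps' : is_sign eps') (hteps' : is_sign teps') :
  r != 0 -> 0 < complex.Re r -> 0 < complex.Re r' ->
  (eps, teps, r) <> (eps', teps', r') ->
  ~ equivalent_rep (Rdisc qP r eps teps heps hteps)
                   (Rdisc qP r' eps' teps' heps' hteps').
Proof.
move=> r0 rpos rpos' neq.
move=> /(equivalent_intertwiner 0%N (Rdisc_irreducible r0)).
move=> [T [TL T0 TM]]; apply: neq.
(* T has no entries between distinct eigenvalues of I. *)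
have TM_I k j : disc_weight eps k * (T << k >>)@_j =
    disc_weight eps' j * (T << k >>)@_j.
  rewrite -(mcoeff_diag (Rdisc_I_diag r' heps' hteps')) -TM Rdisc_I_diag.
  by rewrite (linear_funZ TL) mcoeffZ.
have spec k j : (T << k >>)@_j != 0 -> eps = eps' /\ k = j.
  by move=> vk; apply: disc_weight_inj2 => //; apply: (mulIf vk).
have [k vk] := malg_neq0 (T0 _ (malgU_neq0 _ 0%N)).
have [epsE k0] := spec _ _ vk.
rewrite -{}k0 {k} in vk; set c := (T << 0%N >>)@_0%N in vk.
have Tjk k j : k != j -> (T << k >>)@_j = 0.
  by move=> kj; apply/eqP; apply: contraNT kj => /spec[_ ->].
have TE : T << 0%N >> = c *: << 0%N >>.
  apply/malgP => k; rewrite mcoeffZ mcoeffU; case: eqVneq => [<-|/Tjk ->].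
    by rewrite mulr1.
  by rewrite mulr0.
(* Row 0 of T is c times the coordinate 0, so the entries (0, 0) of
   T * pi(T2) and of pi'(T2) * T can be compared. *)
have T_0 v : (T v)@_0%N = c * v@_0%N.
  apply: (mcoeff_lin_ext TL) => -[|k]; first by rewrite mcoeffUU mulr1.
  by rewrite Tjk // mcoeffU mulr0.
have p1 : p - p^-1 != 0 by have := qhalfBV_neq0 0; rewrite /qhalf expr0 mul1r.
have cancel_eps (d a b a' b' : C) : d != 0 ->
    - (eps * (a / d)) * b = - (eps * (a' / d)) * b' -> a * b = a' * b'.
  move=> d0 E; apply: (mulfI (mulf_neq0 (sign_neq0 heps) (invr_neq0 d0))).
  by apply: oppr_inj; ring: E.
have rE : r * teps = r' * teps'.
  have := T_0 (Rdisc qP r eps teps heps hteps (Uq_T2 p) << 0%N >>).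
  rewrite TM TE (linear_funZ (rep_linear _ _)) mcoeffZ => /(mulfI vk) E.
  apply: (cancel_eps _ _ _ _ _ p1); rewrite [in RHS]epsE.
  apply: etrans (esym (Rdisc_T2_00 r heps hteps)) _.
  exact: etrans (esym E) (Rdisc_T2_00 r' heps' hteps').
have [tE rE'] := sign_Re_inj hteps hteps' rpos rpos' rE.
by rewrite epsE tE rE'.
Qed.

(** Since [e ^+ 2 = 1], the quadratic equation in [z] factors as
    [(z + e * p) * (z + e * p^-1) = 0]. *)
Lemma sum_inv_sign (e z : C) : is_sign e -> z != 0 ->
  z + z^-1 = - (e * (p + p^-1)) -> z = - (e * p) \/ z = - (e * p^-1).
Proof.
move=> he z0 ze; have p0 := generic_p_neq0; have e2 := sign_sqr he.
have : (z + e * p) * (z + e * p^-1) = 0.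
  transitivity (z * (z + z^-1 + e * (p + p^-1))).
    by field: e2; rewrite z0 p0.
  by rewrite ze addNr mulr0.
by move/eqP; rewrite mulf_eq0 !addr_eq0 => /orP[] /eqP; [left|right].
Qed.

Lemma Rdisc_Rrs_nonequivalent (r eps teps r' s' : C)
    (heps : is_sign eps) (hteps : is_sign teps) (hs' : regular_s q s') :
  r != 0 ->
  (forall m : int, s' != 'i * (q ^ m * p) /\ s' != - ('i * (q ^ m * p))) ->
  ~ equivalent_rep (Rdisc qP r eps teps heps hteps) (Rrs qP r' s' hs').
Proof.
move=> r0 s'P.
move=> /(equivalent_intertwiner 0%N (Rdisc_irreducible r0)).
move=> [T [TL T0 TM]].
have Rrs_I_diag m : Rrs qP r' s' hs' (Uq_I p) << m >> =
    ('i * ((s' * q ^ m - s'^-1 * q ^ (- m)) / (q - q^-1))) *: << m >>.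
  by have [hI _ _] := RrsE qP r' hs' m; exact: hI.
have Tev : Rrs qP r' s' hs' (Uq_I p) (T << 0%N >>) =
    disc_weight eps 0 *: T << 0%N >>.
  by rewrite -TM Rdisc_I_diag (linear_funZ TL).
have [m _] := eigenvalue_in_diag Rrs_I_diag (T0 _ (malgU_neq0 _ 0%N)) Tev.
rewrite /disc_weight /qhalf expr0 mul1r => ev.
have q0 := generic_q_neq0; have p0 := generic_p_neq0.
have [s'0 _] := hs'.
have y0 : s' * q ^ m != 0 by rewrite mulf_neq0 ?expfz_neq0.
have i2 : 'i ^+ 2 = -1 :> C := sqrCi C.
have iz0 : 'i * (s' * q ^ m) != 0 by rewrite mulf_neq0 ?neq0Ci.
have zE : 'i * (s' * q ^ m) + ('i * (s' * q ^ m))^-1 = - (eps * (p + p^-1)).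
  have VE : ('i * (s' * q ^ m))^-1 = - ('i * (s'^-1 * q ^ (- m))).
    by rewrite !invfM invCi invr_expz mulNr.
  apply: (mulIf (invr_neq0 generic_qBV)).
  by rewrite VE -mulrBr mulNr -[in RHS]mulrA ev mulrA.
have s'E z : 'i * (s' * q ^ m) = - z -> s' = 'i * (q ^ (- m) * z).
  move=> h; apply: (mulIf (expfz_neq0 m q0)); apply: (mulfI (neq0Ci C)).
  rewrite h [RHS](_ : _ = 'i ^+ 2 * z * (q ^ (- m) * q ^ m)); last by ring.
  by rewrite -expfzDr // addNr expr0z mulr1 i2 mulN1r.
have [pq _ _] := qP.
have pV : p^-1 = q ^ (-1) * p by rewrite exprN1 -pq expr2 invfM mulfVK.
(* both signs of the excluded family of values, packed into eps *)
have excl n : s' = 'i * (q ^ n * (eps * p)) -> False.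
  have [n1 n2] := s'P n; have [->|->] := heps => s'n.
    by move: n1; rewrite {1}s'n mul1r eqxx.
  by move: n2; rewrite {1}s'n mulN1r !mulrN eqxx.
(* z = - eps * p and z = - eps / p are the members n = - m and n = - m - 1. *)
have [/s'E|/s'E s'm] := sum_inv_sign heps iz0 zE; first exact: excl.
apply: (excl (- m - 1)).
by rewrite s'm pV expfzDr // -!mulrA; congr (_ * (_ * _)); rewrite mulrCA.
Qed.

End Spectrum.

Theorem theorem1 (R : realType) (q p : R[i]) (hq : generic_q q p) :
  (forall (r r' eps teps eps' teps' : R[i])
      (heps : is_sign eps) (hteps : is_sign teps)
      (heps' : is_sign eps') (hteps' : is_sign teps'),
    r != 0 -> r' != 0 -> 0 < complex.Re r -> 0 < complex.Re r' ->
    (eps, teps, r) <> (eps', teps', r') ->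
    [/\ irreducible_rep (Rdisc hq r eps teps heps hteps),
        irreducible_rep (Rdisc hq r' eps' teps' heps' hteps')
      & ~ equivalent_rep (Rdisc hq r eps teps heps hteps)
                         (Rdisc hq r' eps' teps' heps' hteps')])
  /\
  (forall (r eps teps r' s' : R[i])
      (heps : is_sign eps) (hteps : is_sign teps) (hs' : regular_s q s'),
    r != 0 -> r' != 0 ->
    (forall m : int, s' != 'i * (q ^ m * p) /\ s' != - ('i * (q ^ m * p))) ->
    ~ equivalent_rep (Rdisc hq r eps teps heps hteps) (Rrs hq r' s' hs')).
Proof.
split=> [r r' eps teps eps' teps' heps hteps heps' hteps' r0 r'0 rpos r'pos neq|].
  by split; [exact: Rdisc_irreducible|exact: Rdisc_irreducible|
    exact: Rdisc_nonequivalent].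
move=> r eps teps r' s' heps hteps hs' r0 _ s'P.
exact: Rdisc_Rrs_nonequivalent.
Qed.
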